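(* Let $F=Ax^2+Bx+C\in\mathbb{Q}[x]$ be nonzero, and let $b_1\in\mathcal{O}$ with $F(b_1)\neq 0$. Then there exists a point $(b_1,a_1,a_2)\in V(F)^{\mathrm{con}}_{1,2}$ if and only if $$\frac{F'(b_1)}{F(b_1)}\in\mathcal{O},\qquad \frac BA\in\mathcal{O},\qquad |F'(b_1)|_p^2>|A|_p\,|F(b_1)|_p.$$ In this case $a_1=-\dfrac{F'(b_1)}{F(b_1)}$ and $a_2=\dfrac{F'(b_1)}{A}$.
   Context: Let $p$ be a fixed odd prime, $|\cdot|_p$ the $p$-adic absolute value, $\mathcal{O}=\mathbb{Z}[1/p]$; the condition $B/A\in\mathcal{O}$ includes $A\neq0$. For a sequence $c_1,c_2,\dots$ put $A_0=1$, $A_1=c_1$, $A_n=c_nA_{n-1}+A_{n-2}$, $B_0=0$, $B_1=1$, $B_n=c_nB_{n-1}+B_{n-2}$; the $n$-th convergent is $[A_n:B_n]\in\mathbb{P}^1(\mathbb{Q})$ and $[c_1,c_2,\dots]$ converges $p$-adically if the convergents converge in $\mathbb{P}^1(\mathbb{Q}_p)$. Let $M(c_1,\dots,c_n)=\prod_{i=1}^n\begin{pmatrix}c_i&1\\1&0\end{pmatrix}$. The periodic continued fraction of type $(1,2)$ is $[b_1,\overline{a_1,a_2}]=[b_1,a_1,a_2,a_1,a_2,\dots]$, identified with $(b_1,a_1,a_2)\in\mathbb{A}^3$. Let $E=(E_{ij})=M(b_1)M(a_1,a_2)M(b_1)^{-1}$; then $E_{21}x^2+(E_{22}-E_{11})x-E_{12}=a_1x^2+(a_2a_1-2b_1a_1)x-a_1a_2b_1+a_1b_1^2-a_2$.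 $V(F)_{1,2}\subseteq\mathbb{A}^3$ is the variety defined by $A(E_{22}-E_{11})=BE_{21}$, $-AE_{12}=CE_{21}$, $-BE_{12}=C(E_{22}-E_{11})$; $V(F)^{\mathrm{con}}_{1,2}$ is the set of its points with coordinates in $\mathcal{O}$ whose continued fraction converges $p$-adically. $F'$ is the derivative of $F$. *)

(* Defs.v *)
From HB Require Import structures.
From mathcomp Require Import all_boot all_order all_algebra.
From mathcomp Require Import generic_quotient ring_quotient.
From mathcomp Require Import ring lra.
From mathcomp Require Import all_classical topology normedtype.

Set Implicit Arguments.
Unset Strict Implicit.
Unset Printing Implicit Defensive.
Import Order.TTheory GRing.Theory Num.Theory.
Local Open Scope ring_scope.

(* The p-adic absolute value on rat, normalized by |p| = 1/p:
   |a/b| is the p-part of b divided by the p-part of a.                       *)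
Definition padic_abs (p : nat) (x : rat) : rat :=
  if x == 0 then 0 else (`|denq x|%N`_p)%:R / (`|numq x|%N`_p)%:R.

Section PadicAbs.
Variable p : nat.
Hypothesis p_pr : prime p.
Local Notation abs := (padic_abs p).

Lemma padic_abs0 : abs 0 = 0.
Proof. by rewrite /padic_abs eqxx. Qed.

Let part_neq0 (n : nat) : (n`_p)%:R != 0 :> rat.
Proof. by rewrite pnatr_eq0 -lt0n part_gt0. Qed.

Lemma padic_abs_frac (a b : int) : a != 0 -> b != 0 ->
  abs (a%:Q / b%:Q) = (`|b|%N`_p)%:R / (`|a|%N`_p)%:R.
Proof.
move=> a0 b0; pose x := a%:Q / b%:Q; rewrite -/x.
have x0 : x != 0 by rewrite mulf_neq0 ?invr_eq0 ?intr_eq0.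
have Ex : a * denq x = b * numq x.
  apply/eqP; rewrite -(eqr_int rat) !intrM.
  rewrite numqE /x.
  by rewrite [eqbRHS]mulrA [b%:~R * _]mulrC divfK // intr_eq0.
rewrite /padic_abs (negPf x0); apply/eqP; rewrite eqr_div //.
rewrite -!natrM -!partnM ?absz_gt0 ?numq_eq0 ?denq_neq0 // -!abszM.
by rewrite [denq x * a]mulrC Ex.
Qed.

Lemma padic_abs1 : abs 1 = 1.
Proof. by have := @padic_abs_frac 1 1 isT isT; rewrite divr1 => ->; rewrite divff. Qed.

Lemma padic_abs_eq0 x : (abs x == 0) = (x == 0).
Proof.
by rewrite /padic_abs; case: ifP => [|_]; rewrite ?eqxx // mulf_eq0 invr_eq0 !(negPf (part_neq0 _)).
Qed.

Lemma padic_abs_ge0 x : 0 <= abs x.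
Proof. by rewrite /padic_abs; case: ifP => // _; rewrite divr_ge0 ?ler0n. Qed.

Lemma padic_absN x : abs (- x) = abs x.
Proof. by rewrite /padic_abs oppr_eq0 denqN numqN abszN. Qed.

Lemma padic_absB x y : abs (x - y) = abs (y - x).
Proof. by rewrite -padic_absN opprB. Qed.

Lemma padic_absM x y : abs (x * y) = abs x * abs y.
Proof.
have [->|x0] := eqVneq x 0; first by rewrite mul0r padic_abs0 mul0r.
have [->|y0] := eqVneq y 0; first by rewrite mulr0 padic_abs0 mulr0.
rewrite -{1}[x]divq_num_den -{1}[y]divq_num_den mulf_div -!intrM.
rewrite padic_abs_frac ?mulf_neq0 ?numq_eq0 ?denq_neq0 //.
rewrite /padic_abs (negPf x0) (negPf y0) !abszM !partnM ?absz_gt0 ?numq_eq0 ?denq_neq0 //.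
by rewrite !natrM mulf_div.
Qed.

Lemma padic_absV x : abs x^-1 = (abs x)^-1.
Proof.
have [->|x0] := eqVneq x 0; first by rewrite !(invr0, padic_abs0).
apply: (mulfI (_ : abs x != 0)); first by rewrite padic_abs_eq0.
by rewrite -padic_absM !mulfV ?padic_abs1 ?padic_abs_eq0.
Qed.

Lemma padic_abs_le (x y z : rat) : abs x <= z -> abs y <= z -> abs (x + y) <= z.
Proof.
have [->|x0] := eqVneq x 0; first by rewrite add0r.
have [->|y0] := eqVneq y 0; first by rewrite addr0.
have [->|s0] := eqVneq (x + y) 0.
  by move=> /(le_trans (padic_abs_ge0 _)); rewrite padic_abs0.
pose d : int := denq x * denq y; pose a : int := numq x * denq y.
pose b : int := numq y * denq x.
have d0 : d != 0 by rewrite mulf_neq0 ?denq_neq0.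
have Ex : x = a%:Q / d%:Q.
  by rewrite !intrM -mulf_div mulfV ?intr_eq0 ?denq_neq0 // mulr1 divq_num_den.
have Ey : y = b%:Q / d%:Q.
  by rewrite /b /d ![_ * denq x]mulrC !intrM -mulf_div mulfV ?intr_eq0 ?denq_neq0 // mul1r divq_num_den.
have a0 : a != 0 by rewrite mulf_neq0 ?denq_neq0 ?numq_eq0.
have b0 : b != 0 by rewrite mulf_neq0 ?denq_neq0 ?numq_eq0.
have Es : x + y = (a + b)%:Q / d%:Q by rewrite Ex Ey -mulrDl intrD.
have ab0 : a + b != 0.
  by apply: contraNneq s0 => ab0; rewrite Es ab0 mul0r.
rewrite Es {1}Ex {1}Ey !padic_abs_frac //.
wlog ab : a b {Ex Ey Es} a0 b0 ab0 / (`|a|%N`_p <= `|b|%N`_p)%N => [W|].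
  have [le|/ltnW le] := leqP (`|a|%N`_p) (`|b|%N`_p); first exact: W.
  by move=> za zb; rewrite addrC; apply: (W b a); rewrite // addrC.
move=> za _; apply: le_trans za.
rewrite ler_pM2l ?ltr0n ?part_gt0 // lef_pV2 ?posrE ?ltr0n ?part_gt0 // ler_nat.
rewrite dvdn_leq ?part_gt0 //.
have dab : (`|a|%N`_p %| `|b|%N`_p)%N.
  by move: ab; rewrite !p_part leq_exp2l ?prime_gt1 // => /dvdn_exp2l ->.
have : (`|a|%N`_p %| absz (a + b)%R)%N.
  have := dvdn_trans dab (dvdn_part p `|b|%N); have := dvdn_part p `|a|%N.
  move=> ha hb; rewrite -[X in (X %| _)%N]absz_nat -dvdzE.
  by apply: rpredD; rewrite dvdzE.
rewrite p_part pfactor_dvdn ?absz_gt0 // => le.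
by rewrite p_part dvdn_exp2l.
Qed.

Lemma padic_absD x y : abs (x + y) <= abs x + abs y.
Proof. by apply: padic_abs_le; rewrite ?lerDl ?lerDr padic_abs_ge0. Qed.

Lemma padic_abs_dist x y : `|abs x - abs y| <= abs (x - y).
Proof.
rewrite ler_norml; apply/andP; split.
  by have := padic_absD (y - x) x; rewrite subrK padic_absB; lra.
by have := padic_absD (x - y) y; rewrite subrK; lra.
Qed.

End PadicAbs.

Local Open Scope classical_set_scope.

(* Q_p is built as the completion of rat for padic_abs: the ring of p-adic
   Cauchy sequences of rationals modulo the ideal of null sequences.          *)
Definition padic_cauchy (p : nat) (p_pr : prime p) : {pred nat -> rat} :=
  fun u => `[< forall e : rat, 0 < e -> exists N, forall m n,
                 (N <= m)%N -> (N <= n)%N -> padic_abs p (u m - u n) < e >].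

Section CauchySequences.
Variables (p : nat) (p_pr : prime p).
Local Notation abs := (padic_abs p).

Lemma padic_abs_lt (x y z : rat) : abs x < z -> abs y < z -> abs (x + y) < z.
Proof.
move=> xz yz; apply: (@le_lt_trans _ _ (Num.max (abs x) (abs y))).
  by apply: padic_abs_le; rewrite // le_max lexx ?orbT.
by rewrite gt_max xz.
Qed.

Lemma padic_cauchyP u : reflect (forall e : rat, 0 < e -> exists N, forall m n,
    (N <= m)%N -> (N <= n)%N -> abs (u m - u n) < e) (u \in padic_cauchy p_pr).
Proof. exact: asboolP. Qed.

Lemma padic_cauchy_bounded u : u \in padic_cauchy p_pr ->
  exists M N, 0 < M /\ forall n, (N <= n)%N -> abs (u n) < M.
Proof.
move=> /padic_cauchyP /(_ 1 ltr01) [N uN].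
exists (abs (u N) + 1), N; have a0 := padic_abs_ge0 p (u N).
split=> [|n Nn]; first lra.
rewrite -(subrK (u N) (u n)); apply: padic_abs_lt; last lra.
by apply: lt_le_trans (uN _ _ Nn (leqnn _)) _; rewrite lerDr.
Qed.

Lemma padic_cauchy_subring : subring_closed (padic_cauchy p_pr).
Proof.
split=> [|u v /padic_cauchyP uC /padic_cauchyP vC|u v uC vC]; apply/padic_cauchyP => e e0.
- by exists 0%N => m n _ _; rewrite subrr padic_abs0.
- have [N uN] := uC _ e0; have [M vM] := vC _ e0.
  exists (maxn N M) => m n; rewrite !geq_max => /andP[Nm Mm] /andP[Nn Mn].
  have -> : (u - v) m - (u - v) n = (u m - u n) + (v n - v m).
    by rewrite [LHS](_ : _ = u m - v m - (u n - v n)) //; ring.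
  by apply: padic_abs_lt; [exact: uN|exact: vM].
- have [A [NA [A0 uA]]] := padic_cauchy_bounded uC.
  have [B [NB [B0 vB]]] := padic_cauchy_bounded vC.
  have [N uN] := padic_cauchyP _ uC _ (divr_gt0 e0 B0).
  have [M vM] := padic_cauchyP _ vC _ (divr_gt0 e0 A0).
  exists (maxn (maxn NA NB) (maxn N M)) => m n; rewrite !geq_max.
  move=> /andP[/andP[NAm NBm] /andP[Nm Mm]] /andP[/andP[NAn NBn] /andP[Nn Mn]].
  have -> : (u * v) m - (u * v) n = (u m - u n) * v m + u n * (v m - v n).
    by rewrite [LHS](_ : _ = u m * v m - u n * v n) //; ring.
  apply: padic_abs_lt; rewrite padic_absM // ltNge; apply/negP.
    move=> h; have : e / B * B <= abs (u m - u n) * abs (v m) by rewrite divfK ?gt_eqF.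
    apply/negP; rewrite -ltNge; apply: ltr_pM; rewrite ?padic_abs_ge0 //.
      exact: uN.
    exact: vB.
  move=> h; have : A * (e / A) <= abs (u n) * abs (v m - v n).
    by rewrite [A * _]mulrC divfK ?gt_eqF.
  apply/negP; rewrite -ltNge; apply: ltr_pM; rewrite ?padic_abs_ge0 //.
    exact: uA.
  exact: vM.
Qed.

HB.instance Definition _ := GRing.isSubringClosed.Build (nat -> rat)
  (padic_cauchy p_pr) padic_cauchy_subring.

Definition padic_seq := {u : nat -> rat | u \in padic_cauchy p_pr}.
HB.instance Definition _ := SubChoice.on padic_seq.
HB.instance Definition _ := [SubChoice_isSubComNzRing of padic_seq by <:].

Definition padic_null : {pred padic_seq} :=
  fun u => `[< forall e : rat, 0 < e ->
                 exists N, forall n, (N <= n)%N -> abs (val u n) < e >].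

Lemma padic_nullP (u : padic_seq) : reflect (forall e : rat, 0 < e ->
    exists N, forall n, (N <= n)%N -> abs (val u n) < e) (u \in padic_null).
Proof. exact: asboolP. Qed.

Lemma padic_null_ideal : idealr_closed padic_null.
Proof.
split=> [||a u v].
- by apply/padic_nullP => e e0; exists 0%N => n _; rewrite raddf0 padic_abs0.
- apply/padic_nullP => /(_ 1 ltr01) [N /(_ N (leqnn N))].
  by rewrite rmorph1 padic_abs1 ltxx.
- move=> /padic_nullP u0 /padic_nullP v0; apply/padic_nullP => e e0.
  have [A [NA [A0 aA]]] := padic_cauchy_bounded (valP a).
  have [N uN] := u0 _ (divr_gt0 e0 A0); have [M vM] := v0 _ e0.
  exists (maxn NA (maxn N M)) => n; rewrite !geq_max => /and3P[NAn Nn Mn].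
  rewrite rmorphD rmorphM /=; apply: padic_abs_lt; last exact: vM.
  rewrite [X in abs X](_ : _ = val a n * val u n) // padic_absM //.
  rewrite -[e](divfK (x := A)) ?gt_eqF // mulrC ltr_pM ?padic_abs_ge0 //.
    exact: uN.
  exact: aA.
Qed.

HB.instance Definition _ := isIdealr.Build padic_seq padic_null padic_null_ideal.

Definition Qp : Type := {ideal_quot padic_null}.
HB.instance Definition _ := GRing.ComNzRing.on Qp.

Definition Qp_class (u : padic_seq) : Qp := (\pi_{ideal_quot padic_null} u)%qT.

Lemma Qp_class_is_zmod_morphism : zmod_morphism Qp_class.
Proof. exact: pi_is_zmod_morphism. Qed.
Lemma Qp_class_is_monoid_morphism : monoid_morphism Qp_class.
Proof. exact: pi_is_monoid_morphism. Qed.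
HB.instance Definition _ :=
  GRing.isZmodMorphism.Build padic_seq Qp Qp_class Qp_class_is_zmod_morphism.
HB.instance Definition _ :=
  GRing.isMonoidMorphism.Build padic_seq Qp Qp_class Qp_class_is_monoid_morphism.

Definition Qp_repr (x : Qp) : padic_seq := repr (x : {ideal_quot padic_null}).

Lemma Qp_reprK : cancel Qp_repr Qp_class.
Proof. exact: reprK. Qed.

Lemma Qp_class_eq0 u : (Qp_class u == 0) = (u \in padic_null).
Proof.
rewrite -(rmorph0 Qp_class) -[RHS]/(u \in padic_null) -[u in RHS]subr0.
by rewrite Quotient.idealrBE.
Qed.

End CauchySequences.

Section PadicField.
Variables (p : nat) (p_pr : prime p).
Local Notation abs := (padic_abs p).
Local Notation Qp := (Qp p_pr).
Local Notation seqp := (padic_seq p_pr).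

Lemma padic_nonnull_away (u : seqp) : u \notin padic_null (p_pr := p_pr) ->
  exists2 c, 0 < c & exists N, forall n, (N <= n)%N -> c <= abs (val u n).
Proof.
move=> u0; have [e e0 ue] : exists2 e, 0 < e &
    forall N, exists2 n, (N <= n)%N & e <= abs (val u n).
  apply: contrapT => H; case/negP: u0; apply/padic_nullP => e e0.
  apply: contrapT => H'; apply: H; exists e => // N.
  apply: contrapT => H; apply: H'; exists N => n Nn.
  by rewrite ltNge; apply/negP => H'; apply: H; exists n.
have [N uN] := padic_cauchyP _ _ (valP u) _ e0; have [n0 Nn0 en0] := ue N.
exists e => //; exists N => n Nn; rewrite leNgt; apply/negP => une.
have := padic_abs_lt p_pr (uN _ _ Nn0 Nn) une.
by rewrite subrK ltNge en0.
Qed.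

Lemma padic_cauchyV (u : seqp) : u \notin padic_null (p_pr := p_pr) ->
  (fun n => (val u n)^-1) \in padic_cauchy p_pr.
Proof.
move=> /padic_nonnull_away [c c0 [N cu]]; apply/padic_cauchyP => e e0.
have [M uM] := padic_cauchyP _ _ (valP u) _ (mulr_gt0 e0 (mulr_gt0 c0 c0)).
exists (maxn N M) => m n; rewrite !geq_max => /andP[Nm Mm] /andP[Nn Mn].
have am := lt_le_trans c0 (cu _ Nm); have an := lt_le_trans c0 (cu _ Nn).
have m0 : val u m != 0 by rewrite -(padic_abs_eq0 p) gt_eqF.
have n0 : val u n != 0 by rewrite -(padic_abs_eq0 p) gt_eqF.
have -> : (val u m)^-1 - (val u n)^-1 =
    (val u n - val u m) / (val u m * val u n) by field; rewrite m0 n0.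
rewrite padic_absM // padic_absV // padic_absM // ltr_pdivrMr ?mulr_gt0 //.
apply: lt_le_trans (uM _ _ Mn Mm) _; rewrite ler_pM2l //.
by apply: ler_pM; rewrite ?cu // ltW.
Qed.

Definition Qp_inv (x : Qp) : Qp :=
  if x == 0 then 0 else Qp_class (insubd 0 (fun n => (val (Qp_repr x) n)^-1)).

Lemma Qp_mulVf x : x != 0 -> Qp_inv x * x = 1.
Proof.
move=> x0; rewrite /Qp_inv (negPf x0); set u := Qp_repr x.
have u0 : u \notin padic_null (p_pr := p_pr) by rewrite -Qp_class_eq0 Qp_reprK.
set v := insubd _ _; rewrite -[X in _ * X]Qp_reprK -/u -rmorphM.
rewrite -(rmorph1 (@Qp_class p p_pr)); apply/eqP; rewrite -subr_eq0 -rmorphB /=.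
rewrite Qp_class_eq0; apply/padic_nullP => e e0.
have [c c0 [N cu]] := padic_nonnull_away u0; exists N => n Nn.
rewrite rmorphB rmorphM rmorph1 /= [X in abs X](_ : _ = val v n * val u n - 1) //.
rewrite /v insubdK ?padic_cauchyV // mulVf ?subrr ?padic_abs0 //.
by rewrite -(padic_abs_eq0 p) gt_eqF // (lt_le_trans c0) // cu.
Qed.

Lemma Qp_inv0 : Qp_inv 0 = 0.
Proof. by rewrite /Qp_inv eqxx. Qed.

HB.instance Definition _ := GRing.ComNzRing_isField.Build Qp Qp_mulVf Qp_inv0.

Lemma padic_cauchy_cst (q : rat) : (fun=> q) \in padic_cauchy p_pr.
Proof. by apply/padic_cauchyP => e e0; exists 0%N => m n _ _; rewrite subrr padic_abs0. Qed.

Definition Qp_of_rat (q : rat) : Qp := Qp_class (Sub (fun=> q) (padic_cauchy_cst q)).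

Lemma Qp_of_rat_is_zmod_morphism : zmod_morphism Qp_of_rat.
Proof. by move=> x y; rewrite -rmorphB; congr Qp_class; exact: val_inj. Qed.
Lemma Qp_of_rat_is_monoid_morphism : monoid_morphism Qp_of_rat.
Proof.
by split=> [|x y]; rewrite -?rmorphM -?(rmorph1 (@Qp_class p p_pr)); congr Qp_class; exact: val_inj.
Qed.
HB.instance Definition _ :=
  GRing.isZmodMorphism.Build rat Qp Qp_of_rat Qp_of_rat_is_zmod_morphism.
HB.instance Definition _ :=
  GRing.isMonoidMorphism.Build rat Qp Qp_of_rat Qp_of_rat_is_monoid_morphism.

(* The absolute value of the class of u is the limit of |u_n|_p; it is
   rational because |u_n|_p is eventually constant unless it tends to 0.      *)
Definition padic_norm (x : Qp) : rat :=
  xget 0 [set a : rat | forall e : rat, 0 < e ->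
    exists N, forall n, (N <= n)%N -> `|abs (val (Qp_repr x) n) - a| < e].

Lemma padic_norm_lim (u : seqp) e : 0 < e ->
  exists N, forall n, (N <= n)%N -> `|abs (val u n) - padic_norm (Qp_class u)| < e.
Proof.
have cv (v : seqp) : exists a : rat, forall e : rat, 0 < e ->
    exists N, forall n, (N <= n)%N -> `|abs (val v n) - a| < e.
  have [v0|v0] := boolP (v \in padic_null (p_pr := p_pr)).
    exists 0 => d d0; have [N vN] := padic_nullP _ v0 _ d0; exists N => n Nn.
    by rewrite subr0 ger0_norm ?padic_abs_ge0 // vN.
  have [c c0 [N cv]] := padic_nonnull_away v0.
  have [M vM] := padic_cauchyP _ _ (valP v) _ c0.
  pose k := maxn N M; exists (abs (val v k)) => d d0; exists k => n kn.
  have Nk : (N <= k)%N by exact: leq_maxl.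
  have Mk : (M <= k)%N by exact: leq_maxr.
  suff -> : abs (val v n) = abs (val v k) by rewrite subrr normr0.
  have d1 := vM _ _ Mk (leq_trans Mk kn); have d2 := vM _ _ (leq_trans Mk kn) Mk.
  have c1 := cv _ Nk; have c2 := cv _ (leq_trans Nk kn).
  apply/eqP; rewrite eq_le; apply/andP; split.
    rewrite -[val v n](subrK (val v k)); apply: padic_abs_le => //.
    by apply: le_trans (ltW d2) c1.
  rewrite -[val v k](subrK (val v n)); apply: padic_abs_le => //.
  by apply: le_trans (ltW d1) c2.
rewrite /padic_norm; set w := Qp_repr _ => e0; case: xgetP => [a _ aw|nw]; last first.
  by have [a aw] := cv w; case: (nw a).
have uw : u - w \in padic_null (p_pr := p_pr).
  by rewrite -Qp_class_eq0 rmorphB /= Qp_reprK subrr.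
have e20 : 0 < e / 2 by rewrite divr_gt0.
have [N uwN] := padic_nullP _ uw _ e20; have [M wM] := aw _ e20.
exists (maxn N M) => n; rewrite geq_max => /andP[Nn Mn].
rewrite [e]splitr; apply: le_lt_trans (ler_distD (abs (val w n)) _ _) _.
apply: ltrD; last exact: wM.
apply: le_lt_trans (padic_abs_dist p_pr _ _) _.
have := uwN _ Nn; rewrite rmorphB /=.
by rewrite [X in abs X](_ : _ = val u n - val w n).
Qed.

Lemma padic_norm_unique (u : seqp) (a : rat) :
  (forall e : rat, 0 < e -> exists N, forall n, (N <= n)%N -> `|abs (val u n) - a| < e) ->
  padic_norm (Qp_class u) = a.
Proof.
move=> ua; apply/eqP; rewrite -subr_eq0 -normr_le0 leNgt; apply/negP => d0.
have d20 := divr_gt0 d0 (ltr0Sn _ 1).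
have [N uN] := ua _ d20; have [M uM] := padic_norm_lim u d20.
have := uN _ (leq_maxl N M); have := uM _ (leq_maxr N M).
set x := abs _; rewrite distrC => h1 h2; have := ltrD h1 h2; rewrite -splitr.
by apply/negP; rewrite -leNgt ler_distD.
Qed.

Lemma padic_norm_eq0 x : padic_norm x = 0 -> x = 0.
Proof.
rewrite -[x]Qp_reprK; set u := Qp_repr x => u0; apply/eqP; rewrite Qp_class_eq0.
apply/padic_nullP => e e0; have [N uN] := padic_norm_lim u e0; exists N => n Nn.
by have := uN _ Nn; rewrite u0 subr0 ger0_norm ?padic_abs_ge0.
Qed.

Lemma padic_norm_rat (q : rat) : padic_norm (Qp_of_rat q) = abs q.
Proof. by apply: padic_norm_unique => e e0; exists 0%N => n _; rewrite subrr normr0. Qed.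

Lemma padic_normN x : padic_norm (- x) = padic_norm x.
Proof.
rewrite -[x]Qp_reprK -rmorphN /=; set u := Qp_repr x; apply: padic_norm_unique => e e0.
have [N uN] := padic_norm_lim u e0; exists N => n Nn; rewrite rmorphN /=.
by rewrite [X in abs X](_ : _ = - val u n) // padic_absN uN.
Qed.

Lemma padic_normD x y : padic_norm (x + y) <= padic_norm x + padic_norm y.
Proof.
rewrite -[x]Qp_reprK -[y]Qp_reprK -rmorphD /=; set u := Qp_repr x; set v := Qp_repr y.
apply/ler_addgt0Pl => e e0; have e30 : 0 < e / 3%:R by rewrite divr_gt0.
have [N uN] := padic_norm_lim u e30; have [M vM] := padic_norm_lim v e30.
have [K wK] := padic_norm_lim (u + v) e30; pose n := maxn N (maxn M K).
have := uN n (leq_maxl _ _).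
have := vM n (leq_trans (leq_maxl _ _) (leq_maxr _ _)).
have := wK n (leq_trans (leq_maxr _ _) (leq_maxr _ _)).
rewrite rmorphD /= [X in abs X](_ : _ = val u n + val v n) //.
have := padic_absD p_pr (val u n) (val v n).
move: (abs (val u n + val v n)) (abs (val u n)) (abs (val v n)) => a b c.
by rewrite !ltr_norml => h /andP[h1 h2] /andP[h3 h4] /andP[h5 h6]; lra.
Qed.

Definition padic_dist (x y : Qp) : rat := padic_norm (x - y).

Lemma padic_distxx x : padic_dist x x = 0.
Proof. by rewrite /padic_dist subrr -(rmorph0 Qp_of_rat) padic_norm_rat padic_abs0. Qed.

Lemma padic_dist_positivity x y : padic_dist x y = 0 -> x = y.
Proof. by move/padic_norm_eq0/eqP; rewrite subr_eq0 => /eqP. Qed.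

Lemma padic_dist_sym x y : padic_dist x y = padic_dist y x.
Proof. by rewrite /padic_dist -padic_normN opprB. Qed.

Lemma padic_dist_triangle y x z : padic_dist x z <= padic_dist x y + padic_dist y z.
Proof. by rewrite /padic_dist (le_trans _ (padic_normD _ _)) // addrA subrK. Qed.

HB.instance Definition _ := isMetric.Build rat Qp
  padic_distxx padic_dist_positivity padic_dist_sym padic_dist_triangle.

End PadicField.

Section PadicProjectiveLine.
Local Open Scope quotient_scope.
Variables (p : nat) (p_pr : prime p).
Local Notation Qp := (Qp p_pr).

Lemma Qp_of_rat_cvg (u : padic_seq p_pr) :
  Qp_of_rat p_pr (val u n) @[n --> \oo] --> (Qp_class u : Qp).
Proof.
apply/cvg_ballP => e e0; have e20 : 0 < e / 2 by rewrite divr_gt0.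
have [N uN] := padic_cauchyP _ _ (valP u) _ e20; near=> n.
have Nn : (N <= n)%N by near: n; exact: nbhs_infty_ge.
rewrite ballEmdist /= /mdist /= /padic_dist -rmorphB /=; set v := _ - _.
have [M vM] := padic_norm_lim v e20; pose m := maxn N M.
have := vM m (leq_maxr _ _); have := uN m n (leq_maxl _ _) Nn.
rewrite /v rmorphB /= [X in _ -> `|padic_abs p X - _| < _ -> _](_ : _ = val u m - val u n) //.
by move: (padic_abs _ _) => a; rewrite ltr_norml => h1 /andP[h2 h3]; lra.
Unshelve. all: by end_near. Qed.

(* P^1(Q_p) is the set of nonzero vectors of Q_p^2 up to nonzero scalars, with
   the quotient topology.                                                     *)
Definition Qp2_nz : set (Qp * Qp) := [set v | v != (0, 0)].

Definition proj_equiv (v w : Qp2_nz) : bool :=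
  `[< exists2 k : Qp, k != 0 & val w = (k * (val v).1, k * (val v).2) >].

Lemma proj_equiv_class : equiv_class_of proj_equiv.
Proof.
have E v w : reflect (exists2 k : Qp, k != 0 & val w = (k * (val v).1, k * (val v).2))
   (proj_equiv v w) by exact: asboolP.
split=> [v|v w|v w t].
- by apply/E; exists 1; rewrite ?oner_neq0 // !mul1r -surjective_pairing.
- apply/E/E => -[k k0 vw]; exists k^-1; rewrite ?invr_eq0 // vw /= !mulKf //;
    exact: surjective_pairing.
- move=> /E[k k0 vw] /E[l l0 wt]; apply/E; exists (l * k).
    by rewrite mulf_neq0.
  by rewrite wt vw /= !mulrA.
Qed.

Canonical proj_equiv_equiv := EquivRelPack proj_equiv_class.
Canonical proj_equiv_encModRel := defaultEncModRel proj_equiv.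

Definition P1_Qp : Type := quotient_topology {eq_quot proj_equiv}.
HB.instance Definition _ := Topological.on P1_Qp.

Definition P1_point (x y : Qp) (xy : (x, y) != (0, 0)) : P1_Qp :=
  \pi_{eq_quot proj_equiv} (exist _ (x, y) (mem_set xy) : Qp2_nz).

End PadicProjectiveLine.

(* Partial quotients are numbered from 1: c 0 is never used.                  *)
Fixpoint cf_num (R : pzSemiRingType) (c : nat -> R) (n : nat) : R :=
  match n with
  | 0 => 1
  | n1.+1 => match n1 with
             | 0 => c 1%N
             | n2.+1 => c n * cf_num c n1 + cf_num c n2
             end
  end.

Fixpoint cf_den (R : pzSemiRingType) (c : nat -> R) (n : nat) : R :=
  match n with
  | 0 => 0
  | n1.+1 => match n1 with
             | 0 => 1
             | n2.+1 => c n * cf_den c n1 + cf_den c n2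
             end
  end.

Lemma cf_det (c : nat -> rat) n :
  cf_num c n.+1 * cf_den c n - cf_num c n * cf_den c n.+1 = (-1) ^+ n.+1.
Proof.
elim: n => [|n IH]; first by rewrite /= expr1; ring.
rewrite [RHS]exprS -IH -[cf_num c n.+2]/(c n.+2 * cf_num c n.+1 + cf_num c n).
by rewrite -[cf_den c n.+2]/(c n.+2 * cf_den c n.+1 + cf_den c n); ring.
Qed.

Lemma convergent_neq0 p (p_pr : prime p) (c : nat -> rat) n :
  (Qp_of_rat p_pr (cf_num c n), Qp_of_rat p_pr (cf_den c n)) != (0, 0).
Proof.
rewrite -pair_eqE /pair_eq /= !fmorph_eq0; apply/negP => /andP[/eqP A0 /eqP B0].
have /eqP := cf_det c n; rewrite A0 B0 mulr0 mul0r subrr eq_sym.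
by rewrite signr_eq0.
Qed.

Definition convergent p (p_pr : prime p) (c : nat -> rat) (n : nat) : P1_Qp p_pr :=
  P1_point (convergent_neq0 p_pr c n).

Definition cf_converges p (p_pr : prime p) (c : nat -> rat) : Prop :=
  exists L : P1_Qp p_pr, convergent p_pr c n @[n --> \oo] --> L.

Definition cf_mx (R : nzRingType) (s : seq R) : 'M[R]_2 :=
  \prod_(c <- s) \matrix_(i < 2, j < 2)
     (if i == 0 then (if j == 0 then c else 1) else (if j == 0 then 1 else 0)).

Definition cf12_mx (b1 a1 a2 : rat) : 'M[rat]_2 :=
  cf_mx [:: b1] * cf_mx [:: a1; a2] * (cf_mx [:: b1])^-1.

Lemma cf12_mx_quadratic (b1 a1 a2 x : rat) (E := cf12_mx b1 a1 a2) :
  E 1 0 * x ^+ 2 + (E 1 1 - E 0 0) * x - E 0 1 =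
  a1 * x ^+ 2 + (a2 * a1 - 2 * b1 * a1) * x - a1 * a2 * b1 + a1 * b1 ^+ 2 - a2.
Proof.
pose N : 'M[rat]_2 := \matrix_(i < 2, j < 2)
     (if i == 0 then (if j == 0 then 0 else 1) else (if j == 0 then 1 else -b1)).
have I : cf_mx [:: b1] * N = 1.
  apply/matrixP => i j; rewrite /cf_mx !big_cons !big_nil mulr1 !mxE !big_ord_recl big_ord0 !mxE /=.
  by case: i => [[|[|//]] ?]; case: j => [[|[|//]] ?] /=; rewrite ?mul1r; ring.
have [U _] := mulmx1_unit I.
have V : (cf_mx [:: b1])^-1 = N by rewrite -[RHS](mulKr U) I mulr1.
rewrite /E /cf12_mx V /cf_mx !big_cons !big_nil !mulr1 /N.
do !rewrite !mxE ?big_ord_recl ?big_ord0 /=.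
ring.
Qed.

(* The sequence b1, a1, a2, a1, a2, ... numbered from 1.                       *)
Definition cf12 (b1 a1 a2 : rat) (n : nat) : rat :=
  if n == 1%N then b1 else if odd n then a2 else a1.

Definition VF12 (A B C : rat) (b1 a1 a2 : rat) : Prop :=
  let E := cf12_mx b1 a1 a2 in
  [/\ A * (E 1 1 - E 0 0) = B * E 1 0,
      - A * E 0 1 = C * E 1 0
    & - B * E 0 1 = C * (E 1 1 - E 0 0)].

Definition in_Zinvp (p : nat) (x : rat) : Prop :=
  exists (k : int) (n : nat), x = k%:~R / p%:R ^+ n.

Definition VF12_con p (p_pr : prime p) (A B C b1 a1 a2 : rat) : Prop :=
  [/\ VF12 A B C b1 a1 a2,
      [/\ in_Zinvp p b1, in_Zinvp p a1 & in_Zinvp p a2]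
    & cf_converges p_pr (cf12 b1 a1 a2)].

(* Main.v *)
(** The relations defining [V(F)] say that [(A, B, C)] is proportional to
    [(a1, a2 a1 - 2 b1 a1, -E12)], which, as soon as [a1 <> 0], forces
    [a1 = -F'(b1)/F(b1)] and [a2 = F'(b1)/A]; hence
    [a1 a2 = -F'(b1)^2 / (A F(b1))], and the whole theorem reduces to the claim
    that [b1, a1, a2, a1, a2, ...] converges iff [|a1 a2| > 1].

    If [|a1 a2| > 1], the ultrametric inequality gives [|B_n| = |c_n| |B_(n-1)|],
    so [|B_n B_(n+1)|] grows geometrically and [A_n/B_n], whose increments are
    [+-1/(B_n B_(n+1))], is Cauchy.  If [|a1 a2| <= 1], the [A_n] and [B_n] are
    bounded, and as [A_(n+1) B_n - A_n B_(n+1) = +-1], consecutive convergents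
    stay at a distance bounded below; this case includes [a1 = 0]. *)

Require Import Defs.
From mathcomp Require Import all_boot all_order all_algebra.
From mathcomp Require Import generic_quotient ring lra.
From mathcomp Require Import all_classical topology.
Set Implicit Arguments.
Unset Strict Implicit.
Import Order.TTheory GRing.Theory Num.Theory.
Local Open Scope ring_scope.

(** * Closure properties of Z[1/p] *)

Section Zinvp.
Variables (p : nat) (p_pr : prime p).

Let pX_neq0 n : p%:R ^+ n != 0 :> rat.
Proof. by rewrite expf_neq0 // pnatr_eq0 -lt0n prime_gt0. Qed.

Lemma in_ZinvpD x y : in_Zinvp p x -> in_Zinvp p y -> in_Zinvp p (x + y).
Proof.
move=> [k [m ->]] [l [n ->]]; exists (k * p%:Z ^+ n + l * p%:Z ^+ m), (m + n)%N.
by rewrite addf_div // -exprD intrD !intrM !rmorphXn.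
Qed.

Lemma in_ZinvpN x : in_Zinvp p x -> in_Zinvp p (- x).
Proof. by move=> [k [n ->]]; exists (- k), n; rewrite rmorphN mulNr. Qed.

End Zinvp.

(** By Bernoulli's inequality, [a ^+ n] is at least [1 + n h] with [h = a - 1 > 0]. *)
Lemma exprn_unbounded (R : archiRealFieldType) (a M : R) : 1 < a ->
  exists N, forall n, (N <= n)%N -> M < a ^+ n.
Proof.
rewrite -subr_gt0; set h := a - 1 => h0.
have bernoulli n : 1 + n%:R * h <= a ^+ n.
  elim: n => [|n IH]; first by rewrite mul0r addr0 expr0.
  rewrite exprS -natr1; apply: (@le_trans _ _ (a * (1 + n%:R * h))).
    have : 0 <= n%:R * h * h by rewrite !mulr_ge0 ?ler0n // ltW.
    by rewrite -(subrK 1 a) -/h; move: n%:R => k; clearbody h; lra.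
  by rewrite ler_pM2l //; rewrite /h in h0; lra.
exists (Num.bound (`|M| / h)) => n Nn.
have M0 : 0 <= `|M| / h by rewrite divr_ge0 // ltW.
apply: lt_le_trans (bernoulli n); apply: le_lt_trans (ler_norm M) _.
rewrite ltr_wpDl // -ltr_pdivrMr //.
by rewrite (lt_le_trans (archi_boundP M0)) // ler_nat.
Qed.

(** * The p-adic absolute value on Q and on Q_p *)

Section PadicNorm.
Variables (p : nat) (p_pr : prime p).
Local Notation Qp := (Qp p_pr).
Local Notation abs := (padic_abs p).

(** If [|x + y| < |x|] held, [x = (x + y) - y] would be a sum of two terms smaller than [|x|]. *)
Lemma padic_abs_addr_dominant x y : abs y < abs x -> abs (x + y) = abs x.
Proof.
move=> yx; apply/eqP; rewrite eq_le padic_abs_le ?(ltW yx) //=.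
rewrite leNgt; apply/negP => xyx.
have := padic_abs_lt p_pr xyx (y := - y); rewrite padic_absN => /(_ yx).
by rewrite addrK ltxx.
Qed.

Lemma padic_norm_ge0 (x : Qp) : 0 <= padic_norm x.
Proof.
have := padic_normD x (- x); rewrite padic_normN subrr.
by rewrite -(rmorph0 (Qp_of_rat p_pr)) padic_norm_rat padic_abs0; lra.
Qed.

Lemma padic_norm_gt0 (x : Qp) : x != 0 -> 0 < padic_norm x.
Proof.
move=> x0; rewrite lt_neqAle padic_norm_ge0 andbT eq_sym.
by apply: contra_neq x0 => /padic_norm_eq0.
Qed.

Lemma padic_normM (x y : Qp) : padic_norm (x * y) = padic_norm x * padic_norm y.
Proof.
have := padic_norm_ge0 x; have := padic_norm_ge0 y.
rewrite -[x]Qp_reprK -[y]Qp_reprK -rmorphM /=.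
set u := Qp_repr x; set v := Qp_repr y; set b := padic_norm _; set a := padic_norm _.
move=> b0 a0; apply: padic_norm_unique => e e0.
have s0 : 0 < 2 + a + b by lra.
(* With both errors below [d <= 1], the product is off by at most [d (1 + a + b)]; the 2 in place of
   1 makes the final bound strict. *)
have d0 : 0 < Num.min 1 (e / (2 + a + b)) by rewrite lt_min ltr01 divr_gt0.
have [N uN] := padic_norm_lim u d0; have [M vM] := padic_norm_lim v d0.
exists (maxn N M) => n; rewrite geq_max => /andP[/uN Nn /vM Mn].
rewrite rmorphM [X in abs X](_ : _ = val u n * val v n) // padic_absM //.
move: d0 Nn Mn; rewrite -/a -/b; move: (abs (val u n)) (abs (val v n)) => s t.
set d := Num.min _ _ => d0 sd td.
have d1 : d <= 1 by rewrite ge_min lexx.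
have de : d * (2 + a + b) <= e.
  by rewrite -ler_pdivlMr // ge_min lexx orbT.
rewrite (_ : s * t - a * b = (s - a) * (t - b) + (a * (t - b) + b * (s - a))); last ring.
have h1 : `|(s - a) * (t - b)| <= d * 1.
  by rewrite normrM ler_pM ?normr_ge0 // ?ltW // (lt_le_trans td).
have h2 : `|a * (t - b)| <= a * d by rewrite normrM ger0_norm // ler_wpM2l // ltW.
have h3 : `|b * (s - a)| <= b * d by rewrite normrM ger0_norm // ler_wpM2l // ltW.
apply: le_lt_trans (ler_normD _ _) _.
have := ler_normD (a * (t - b)) (b * (s - a)); nra.
Qed.

(** By the ultrametric inequality, a sum of increments smaller than [e] is still smaller than [e],
    however many there are. *)
Lemma padic_cauchy_of_diff (u : nat -> rat) :
  (forall e : rat, 0 < e -> exists N, forall n, (N <= n)%N -> abs (u n.+1 - u n) < e) ->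
  u \in padic_cauchy p_pr.
Proof.
move=> uD; apply/padic_cauchyP => e e0; have [N uN] := uD _ e0; exists N.
have le k m : (N <= m)%N -> abs (u (m + k)%N - u m) < e.
  move=> Nm; elim: k => [|k IH]; first by rewrite addn0 subrr padic_abs0.
  rewrite addnS -(subrKA (u (m + k)%N)); apply: padic_abs_lt => //.
  by apply: uN; rewrite (leq_trans Nm) ?leq_addr.
move=> m n Nm Nn; have [mn|nm] := leqP m n.
  by rewrite padic_absB -(subnKC mn) le.
by rewrite -(subnKC (ltnW nm)) le.
Qed.

End PadicNorm.

(** * Convergence and non-convergence in the projective line over Q_p *)

Section ProjectiveLine.
Local Open Scope classical_set_scope.
Local Open Scope quotient_scope.
Variables (p : nat) (p_pr : prime p).
Local Notation Qp := (Qp p_pr).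
Local Notation abs := (padic_abs p).

Local Notation piQ := (\pi_{eq_quot (@proj_equiv p p_pr)}).

Lemma P1_affine_neq0 (x : Qp) : (x, 1) != (0, 0) :> Qp * Qp.
Proof. by rewrite -pair_eqE /pair_eq /= oner_eq0 andbF. Qed.

Lemma P1_point_affine (x y : Qp) (xy : (x, y) != (0, 0)) : y != 0 ->
  P1_point xy = P1_point (P1_affine_neq0 (x / y)).
Proof.
move=> y0; apply/eqquotP/asboolP; exists y^-1; rewrite ?invr_eq0 //=.
by rewrite mulVf // mulrC.
Qed.

(** An open set of the quotient pulls back to the trace on nonzero vectors of an open set of the
    plane, and there [(u n, 1)] tends to [(x, 1)]. *)
Lemma P1_affine_cvg (u : nat -> Qp) (x : Qp) : u n @[n --> \oo] --> x ->
  P1_point (P1_affine_neq0 (u n)) @[n --> \oo] --> P1_point (P1_affine_neq0 x).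
Proof.
move=> ux U; rewrite nbhsE => -[V [oV Vx] VU].
have [O oO OV] : open (piQ @^-1` V : set (@Qp2_nz p p_pr)) by exact: oV.
have Ox : O (x, 1).
  suff : (val @^-1` O : set (@Qp2_nz p p_pr)) (exist _ (x, 1) (mem_set (P1_affine_neq0 x))) by [].
  by rewrite OV.
have ux1 : (u n, 1 : Qp) @[n --> \oo] --> (x, 1 : Qp) by exact: (cvg_pair ux (cvg_cst (1 : Qp))).
have nO : nbhs (x, 1 : Qp) O by apply: open_nbhs_nbhs; split.
have : \forall n \near \oo, O (u n, 1) by exact: ux1.
rewrite -[X in _ -> X]/(\forall n \near \oo, U (P1_point (P1_affine_neq0 (u n)))).
apply: filterS => n On.
apply: VU.
suff : (piQ @^-1` V : set (@Qp2_nz p p_pr))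
   (exist _ (u n, 1) (mem_set (P1_affine_neq0 (u n)))) by [].
by rewrite -OV.
Qed.

(* The defining inequality is homogeneous in [v], so it does not depend on the
   representative chosen by [repr]; see [chordal_ballE]. *)
Definition chordal_ball (x y : Qp) (e : rat) : set (P1_Qp p_pr) :=
  [set l | let v := val (repr (l : {eq_quot @proj_equiv p p_pr})) in
    padic_norm (v.1 * y - v.2 * x) < e * (padic_norm v.1 + padic_norm v.2)].

Lemma chordal_ballE x y e (t : @Qp2_nz p p_pr) :
  chordal_ball x y e (piQ t) =
  (padic_norm ((val t).1 * y - (val t).2 * x)
     < e * (padic_norm (val t).1 + padic_norm (val t).2)) :> Prop.
Proof.
rewrite /chordal_ball /=.
have /eqquotP/asboolP[k k0 ->] : piQ t = piQ (repr (piQ t)) by rewrite reprK.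
have nk0 := padic_norm_gt0 k0.
rewrite /= -!mulrA -mulrBr !padic_normM -mulrDr mulrCA.
by rewrite (ltr_pM2l nk0).
Qed.

Lemma chordal_ball_open x y e : 0 < e -> open (chordal_ball x y e).
Proof.
move=> e0; pose O : set (Qp * Qp) :=
  [set v | padic_norm (v.1 * y - v.2 * x) < e * (padic_norm v.1 + padic_norm v.2)].
have oO : open O.
  rewrite openE => -[v w]; rewrite /O /=.
  set d := _ * (_ + _) => vd.
  have x0 := padic_norm_ge0 x; have y0 := padic_norm_ge0 y.
  (* Moving [v] and [w] by less than [r] changes the left side by at most [r (|x| + |y|)] and the
     right side by at most [2 e r]; [r] makes the total equal to the gap at [(v, w)]. *)
  pose s := e *+ 2 + padic_norm x + padic_norm y.
  have s0 : 0 < s by rewrite /s; lra.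
  pose r := (d - padic_norm (v * y - w * x)) / s.
  have r0 : 0 < r by rewrite divr_gt0 // subr_gt0.
  have rs : r * s = d - padic_norm (v * y - w * x) by rewrite divfK ?gt_eqF.
  apply/nbhs_ballP; exists r => // -[v' w'] [].
  rewrite !ballEmdist /= /mdist /= /padic_dist => vr wr.
  have h1 : padic_norm v <= padic_norm (v - v') + padic_norm v'.
    by rewrite -{1}(subrK v' v) padic_normD.
  have h2 : padic_norm w <= padic_norm (w - w') + padic_norm w'.
    by rewrite -{1}(subrK w' w) padic_normD.
  have -> : v' * y - w' * x = (v * y - w * x) + ((w - w') * x + - ((v - v') * y)) by ring.
  apply: le_lt_trans (padic_normD _ _) _.
  apply: le_lt_trans (lerD (lexx _) (padic_normD _ _)) _.
  rewrite padic_normN !padic_normM.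
  move: rs vr wr h1 h2; rewrite /s /d.
  move: (padic_norm (v - v')) (padic_norm (w - w')) (padic_norm x) (padic_norm y) x0 y0 => a b X Y.
  move: (padic_norm _) (padic_norm v) (padic_norm w) (padic_norm v') (padic_norm w').
  clearbody r => D nv nw nv' nw' x0 y0 rs ar br h1 h2.
  have k1 : e * nv <= e * a + e * nv' by rewrite -mulrDr ler_pM2l.
  have k2 : e * nw <= e * b + e * nw' by rewrite -mulrDr ler_pM2l.
  have k3 : e * a < e * r by rewrite ltr_pM2l.
  have k4 : e * b < e * r by rewrite ltr_pM2l.
  have k5 : a * Y <= r * Y by rewrite ler_wpM2r // ltW.
  have k6 : b * X <= r * X by rewrite ler_wpM2r // ltW.
  nra.
(* The preimage of the ball under the quotient map is the trace of [O] on nonzero vectors. *)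
exists O => //; apply/seteqP.
by split=> t tP; [change (chordal_ball x y e (piQ t))|
  have {}tP : chordal_ball x y e (piQ t) by []]; rewrite chordal_ballE in tP *.
Qed.

(** Near a limit [[x : y]], boundedness makes [a_n y - b_n x] small for two consecutive indices.
    This linear system in [x] and [y] has a determinant of absolute value 1, so [x] and [y] are
    themselves too small. *)
Lemma P1_bounded_not_cvg (a b : nat -> rat) (K : rat)
    (ab_neq0 : forall n, (Qp_of_rat p_pr (a n), Qp_of_rat p_pr (b n)) != (0, 0))
    (L : P1_Qp p_pr) :
  (forall n, abs (a n) <= K) -> (forall n, abs (b n) <= K) ->
  (forall n, abs (a n.+1 * b n - a n * b n.+1) = 1) ->
  ~ (P1_point (ab_neq0 n) @[n --> \oo] --> L).
Proof.
move=> aK bK ab1 cv.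
pose t := repr (L : {eq_quot @proj_equiv p p_pr}).
have Lt : L = piQ t by rewrite reprK.
pose x := (val t).1; pose y := (val t).2; pose s := padic_norm x + padic_norm y.
have x0 := padic_norm_ge0 x; have y0 := padic_norm_ge0 y.
have s0 : 0 < s.
  rewrite lt_neqAle addr_ge0 // andbT eq_sym paddr_eq0 //; apply/negP.
  move=> /andP[/eqP/padic_norm_eq0 xE /eqP/padic_norm_eq0 yE].
  have := set_mem (valP t); rewrite /Qp2_nz /= [val t]surjective_pairing -/x -/y xE yE.
  by rewrite eqxx.
(* The argument yields [|x|, |y| <= 4 e K^2], hence [s <= 8 e K^2 < s]. *)
pose e := s / (K ^+ 2 *+ 8 + 1).
have k0 : 0 < K ^+ 2 *+ 8 + 1 by have := sqr_ge0 K; lra.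
have e0 : 0 < e by rewrite divr_gt0.
have eE : e * (K ^+ 2 *+ 8 + 1) = s by rewrite divfK ?gt_eqF.
have BL : nbhs L (chordal_ball x y e).
  apply: open_nbhs_nbhs; split; first exact: chordal_ball_open.
  rewrite Lt chordal_ballE -/x -/y mulrC subrr -(rmorph0 (Qp_of_rat p_pr)).
  by rewrite padic_norm_rat padic_abs0 mulr_gt0.
have [N _ NB] : \forall n \near \oo, chordal_ball x y e (P1_point (ab_neq0 n)) by exact: (cv _ BL).
have close n : (N <= n)%N ->
    padic_norm (Qp_of_rat p_pr (a n) * y - Qp_of_rat p_pr (b n) * x) <= 2 * e * K.
  move=> /NB; rewrite /= /P1_point chordal_ballE /= !padic_norm_rat => /ltW h.
  apply: le_trans h _; have := aK n; have := bK n; nra.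
have h0 := close N (leqnn N); have h1 := close N.+1 (leqnSn N).
have K0 : 0 <= K by apply: le_trans (aK 0%N); exact: padic_abs_ge0.
have det z : padic_norm z =
    padic_norm (z * Qp_of_rat p_pr (a N.+1 * b N - a N * b N.+1)).
  by rewrite padic_normM padic_norm_rat ab1 mulr1.
have comb (c d : rat) (z w : Qp) : abs c <= K -> abs d <= K ->
    padic_norm z <= 2 * e * K -> padic_norm w <= 2 * e * K ->
    padic_norm (Qp_of_rat p_pr c * z - Qp_of_rat p_pr d * w) <= e * K ^+ 2 *+ 4.
  move=> cK dK zK wK; apply: le_trans (padic_normD _ _) _.
  rewrite padic_normN !padic_normM !padic_norm_rat.
  have -> : e * K ^+ 2 *+ 4 = K * (2 * e * K) + K * (2 * e * K) by ring.
  by apply: lerD; apply: ler_pM; rewrite ?padic_abs_ge0 ?padic_norm_ge0.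
(* Cramer's rule: multiplying by the determinant expresses [x], and then [y], through the two small
   quantities. *)
have hx : padic_norm x <= e * K ^+ 2 *+ 4.
  rewrite det rmorphB !rmorphM /=.
  rewrite [X in padic_norm X](_ : _ = Qp_of_rat p_pr (a N) *
     (Qp_of_rat p_pr (a N.+1) * y - Qp_of_rat p_pr (b N.+1) * x) - Qp_of_rat p_pr (a N.+1) *
     (Qp_of_rat p_pr (a N) * y - Qp_of_rat p_pr (b N) * x)); last by ring.
  exact: comb.
have hy : padic_norm y <= e * K ^+ 2 *+ 4.
  rewrite det rmorphB !rmorphM /=.
  rewrite [X in padic_norm X](_ : _ = Qp_of_rat p_pr (b N) *
     (Qp_of_rat p_pr (a N.+1) * y - Qp_of_rat p_pr (b N.+1) * x) - Qp_of_rat p_pr (b N.+1) *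
     (Qp_of_rat p_pr (a N) * y - Qp_of_rat p_pr (b N) * x)); last by ring.
  exact: comb.
move: eE; rewrite /s; lra.
Qed.

End ProjectiveLine.

(** * Convergence criterion for [[b1, a1, a2, a1, a2, ...]] *)

Section ContinuedFraction.
Local Open Scope classical_set_scope.
Variables (p : nat) (p_pr : prime p).
Local Notation abs := (padic_abs p).

Lemma cf12S b1 a1 a2 n : cf12 b1 a1 a2 n.+2 = if odd n then a2 else a1.
Proof. by rewrite /cf12 /= negbK. Qed.

Lemma cf_numSS (c : nat -> rat) n :
  cf_num c n.+2 = c n.+2 * cf_num c n.+1 + cf_num c n.
Proof. by []. Qed.

Lemma cf_denSS (c : nat -> rat) n :
  cf_den c n.+2 = c n.+2 * cf_den c n.+1 + cf_den c n.
Proof. by []. Qed.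

(** One of [a1], [a2] may be large, so even and odd terms get separate bounds, which the recurrence
    preserves by the ultrametric inequality. *)
Lemma cf12_recurrence_bounded (b1 a1 a2 : rat) (x : nat -> rat) :
  (forall n, x n.+2 = cf12 b1 a1 a2 n.+2 * x n.+1 + x n) ->
  abs (a1 * a2) <= 1 -> exists K, forall n, abs (x n) <= K.
Proof.
move=> xS; rewrite padic_absM // => a12.
have g0 := padic_abs_ge0 p.
(* [K0] bounds the even terms and [K1] the odd ones. *)
have [K0 [K1 [x0 x1 le1 le2]]] : exists K0 K1, [/\ abs (x 0%N) <= K0, abs (x 1%N) <= K1,
    abs a1 * K1 <= K0 & abs a2 * K0 <= K1].
  have [a10|a10] := eqVneq a1 0.
    exists (abs (x 0%N)), (Num.max (abs (x 1%N)) (abs a2 * abs (x 0%N))).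
    by rewrite a10 padic_abs0 mul0r !le_max !lexx orbT g0.
  have pa1 : 0 < abs a1 by rewrite lt_neqAle g0 eq_sym padic_abs_eq0 a10.
  (* With [K0 = |a1| K1], the condition [|a2| K0 <= K1] is exactly where [|a1 a2| <= 1] enters. *)
  pose K1 := Num.max (abs (x 1%N)) (abs (x 0%N) / abs a1).
  exists (abs a1 * K1), K1; split=> //; last first.
  - rewrite mulrA [abs a2 * _]mulrC ler_piMl // le_max g0 //.
  - by rewrite le_max lexx.
  - by rewrite mulrC -ler_pdivrMr // le_max lexx orbT.
have xK n : abs (x n.*2) <= K0 /\ abs (x n.*2.+1) <= K1.
  elim: n => [//|n [IH0 IH1]].
  have h : abs (x n.+1.*2) <= K0.
    rewrite doubleS xS cf12S odd_double; apply: padic_abs_le => //.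
    by rewrite padic_absM // (le_trans _ le1) // ler_wpM2l.
  split=> //; rewrite doubleS xS cf12S /= odd_double /=; apply: padic_abs_le => //.
  by rewrite padic_absM // (le_trans _ le2) // ler_wpM2l.
exists (Num.max K0 K1) => n; rewrite -(odd_double_half n) le_max.
by have [h0 h1] := xK n./2; case: odd; rewrite ?add0n ?add1n ?h0 ?h1 ?orbT.
Qed.

Lemma cf12_not_converges (b1 a1 a2 : rat) :
  abs (a1 * a2) <= 1 -> ~ cf_converges p_pr (cf12 b1 a1 a2).
Proof.
move=> a12 [L]; set c := cf12 _ _ _.
have [KA AK] := cf12_recurrence_bounded (cf_numSS c) a12.
have [KB BK] := cf12_recurrence_bounded (cf_denSS c) a12.
apply: (@P1_bounded_not_cvg p p_pr _ _ (Num.max KA KB)) => n.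
- by rewrite le_max AK.
- by rewrite le_max BK orbT.
- rewrite cf_det; elim: n => [|n IH]; first by rewrite expr1 padic_absN padic_abs1.
  by rewrite exprS mulN1r padic_absN.
Qed.

Lemma abs_cf12_den (b1 a1 a2 : rat) n : 1 < abs (a1 * a2) ->
  abs (cf_den (cf12 b1 a1 a2) n.+2) =
  abs (cf12 b1 a1 a2 n.+2) * abs (cf_den (cf12 b1 a1 a2) n.+1).
Proof.
move=> a12; set c := cf12 _ _ _.
have pcc k : abs (c k.+2) * abs (c k.+3) = abs (a1 * a2).
  by rewrite padic_absM // /c !cf12S /=; case: odd; rewrite //= mulrC.
(* This invariant says that the first term dominates in the recurrence for [B_(k+2)]. *)
suff H k : abs (cf_den c k) < abs (c k.+2) * abs (cf_den c k.+1).
  by rewrite cf_denSS padic_abs_addr_dominant ?padic_absM.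
elim: k => [|k IH].
  rewrite /= padic_abs0 padic_abs1 // mulr1 lt_neqAle padic_abs_ge0 andbT eq_sym.
  apply/negP => /eqP c2; have := pcc 0%N; rewrite c2 mul0r => E.
  by move: a12; rewrite -E ltr10.
have -> : abs (cf_den c k.+2) = abs (c k.+2) * abs (cf_den c k.+1).
  by rewrite cf_denSS padic_abs_addr_dominant ?padic_absM.
(* Two consecutive quotients contribute [|a1 a2| > 1]; it remains that [B_(k+1)] is nonzero, which
   the strict induction hypothesis gives. *)
rewrite mulrA [abs (c _) * abs (c _)]mulrC pcc ltr_pMl //.
rewrite lt_neqAle padic_abs_ge0 andbT eq_sym; apply/negP => /eqP d0.
by move: IH; rewrite d0 mulr0 ltNge padic_abs_ge0.
Qed.

Lemma cf12_converges (b1 a1 a2 : rat) :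
  1 < abs (a1 * a2) -> cf_converges p_pr (cf12 b1 a1 a2).
Proof.
move=> a12; set c := cf12 _ _ _.
have pa : 0 < abs (a1 * a2) by lra.
have a10 : a1 != 0 by apply: contraTneq a12 => ->; rewrite mul0r padic_abs0 ltr10.
have pa1 : 0 < abs a1 by rewrite lt_neqAle padic_abs_ge0 eq_sym padic_abs_eq0 a10.
pose D n := abs (cf_den c n.+1 * cf_den c n.+2).
(* Each step multiplies by [|c_(n+2) c_(n+3)| = |a1 a2|]. *)
have DE n : D n = abs a1 * abs (a1 * a2) ^+ n.
  elim: n => [|n IH].
    by rewrite /D /= addr0 mul1r mulr1 expr0 mulr1.
  rewrite exprS mulrCA -IH /D !padic_absM // (abs_cf12_den b1 n.+1 a12) // -/c.
  have -> : abs a1 * abs a2 = abs (c n.+2) * abs (c n.+3).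
    by rewrite /c !cf12S /=; case: odd; rewrite //= mulrC.
  by rewrite {1}(abs_cf12_den b1 n a12) // -/c; ring.
have den0 n : cf_den c n.+1 != 0.
  have : D n != 0 by rewrite DE mulf_neq0 ?expf_neq0 // gt_eqF.
  by rewrite padic_abs_eq0 mulf_eq0 negb_or => /andP[].
(* The index starts at 1 because [B_0 = 0]; the shift is undone at the end by [near_inftyS]. *)
pose u n := cf_num c n.+1 / cf_den c n.+1.
have uC : u \in padic_cauchy p_pr.
  apply: padic_cauchy_of_diff => e e0.
  (* The increment of [u] at [n] has absolute value [1 / (|a1| |a1 a2|^n)]. *)
  have [N NE] : exists N, forall n, (N <= n)%N -> (e * abs a1)^-1 < abs (a1 * a2) ^+ n.
    exact: exprn_unbounded.
  exists N => n Nn.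
  have -> : u n.+1 - u n = (-1) ^+ n.+2 / (cf_den c n.+1 * cf_den c n.+2).
    by rewrite -(cf_det c) /u; field; rewrite !den0.
  rewrite padic_absM // padic_absV // -/(D n) DE.
  have -> : abs ((-1) ^+ n.+2) = 1.
    by elim: n.+2 => [|k IH]; rewrite ?expr0 ?padic_abs1 // exprS mulN1r padic_absN.
  rewrite mul1r invf_plt ?posrE ?mulr_gt0 ?exprn_gt0 //.
  by rewrite -ltr_pdivrMl // -invfM mulrC NE.
exists (P1_point (P1_affine_neq0 (Qp_class (Sub u uC)))).
have cv := P1_affine_cvg (@Qp_of_rat_cvg _ p_pr (Sub u uC)).
move=> U /cv UL; apply: near_inftyS.
have : \forall n \near \oo, U (P1_point (P1_affine_neq0 (Qp_of_rat p_pr (u n)))) by exact: UL.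
apply: filterS => n; rewrite /u fmorph_div -(P1_point_affine (convergent_neq0 p_pr c n.+1)) //.
by rewrite fmorph_eq0.
Qed.

End ContinuedFraction.

(** * Equations of the variety and the equivalence *)

(** Evaluating the quadratic identity at 0, 1 and -1 determines its coefficients, so the matrix
    product need not be expanded again. *)
Lemma VF12E (A B C b1 a1 a2 : rat) : VF12 A B C b1 a1 a2 <->
  [/\ A * (a2 * a1 - 2 * b1 * a1) = B * a1,
      A * (- a1 * a2 * b1 + a1 * b1 ^+ 2 - a2) = C * a1
    & B * (- a1 * a2 * b1 + a1 * b1 ^+ 2 - a2) = C * (a2 * a1 - 2 * b1 * a1)].
Proof.
rewrite /VF12 /=; have := cf12_mx_quadratic b1 a1 a2; move: (cf12_mx _ _ _) => E /= q.
have q0 : - E 0 1 = - a1 * a2 * b1 + a1 * b1 ^+ 2 - a2 by have := q 0; lra.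
have q2 : E 1 0 = a1 by have := q 1; have := q (-1); move: q0; lra.
have q1 : E 1 1 - E 0 0 = a2 * a1 - 2 * b1 * a1 by have := q 1; move: q0 q2; lra.
by rewrite -q0 q2 q1 !mulNr !mulrN.
Qed.

Theorem theorem4p14 (p : nat) (p_pr : prime p) (p_odd : odd p)
    (A B C : rat) (F : {poly rat})
    (F_def : F = A *: 'X^2 + B *: 'X + C%:P) (F_neq0 : F != 0)
    (b1 : rat) (b1_O : in_Zinvp p b1) (Fb1_neq0 : F.[b1] != 0) :
  ((exists a1 a2 : rat, VF12_con p_pr A B C b1 a1 a2) <->
    [/\ in_Zinvp p (F^`().[b1] / F.[b1]),
        A != 0 /\ in_Zinvp p (B / A)
      & padic_abs p F^`().[b1] ^+ 2 > padic_abs p A * padic_abs p F.[b1]])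
  /\
  (forall a1 a2 : rat, VF12_con p_pr A B C b1 a1 a2 ->
     a1 = - (F^`().[b1] / F.[b1]) /\ a2 = F^`().[b1] / A).
Proof.
have FE : F.[b1] = A * b1 ^+ 2 + B * b1 + C by rewrite F_def !hornerE.
have F'E : F^`().[b1] = 2 * A * b1 + B.
  by rewrite F_def !derivE !hornerE; ring.
have ABC : A = 0 -> B = 0 -> C = 0 -> False.
  by move=> A0 B0 C0; case/eqP: F_neq0; rewrite F_def A0 B0 C0 !scale0r !add0r.
move: F.[b1] F^`().[b1] FE F'E Fb1_neq0 => f f' FE F'E f0.
(* For the predicted values, [|a1 a2| = |f'|^2 / (|A| |f|)]. *)
have abs_a12 : A != 0 -> (1 < padic_abs p (- (f' / f) * (f' / A))) =
    (padic_abs p A * padic_abs p f < padic_abs p f' ^+ 2).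
  move=> A0; rewrite mulNr padic_absN mulf_div !padic_absM // padic_absV // padic_absM //.
  rewrite ltr_pdivlMr ?mul1r ?[padic_abs p A * _]mulrC // mulr_gt0 // lt_neqAle.
    by rewrite padic_abs_ge0 eq_sym padic_abs_eq0 f0.
  by rewrite padic_abs_ge0 eq_sym padic_abs_eq0 A0.
have necessary a1 a2 : VF12_con p_pr A B C b1 a1 a2 ->
    [/\ A != 0, a1 = - (f' / f), a2 = f' / A & 1 < padic_abs p (a1 * a2)].
  move=> [/VF12E[e1 e2 e3] _ cv].
  have a12 : 1 < padic_abs p (a1 * a2).
    by rewrite ltNge; apply/negP => /(@cf12_not_converges _ p_pr b1).
  (* From here on [a1] can be cancelled in the relations of the variety. *)
  have a10 : a1 != 0 by apply: contraTneq a12 => ->; rewrite mul0r padic_abs0 ltr10.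
  have BE : A * (a2 - 2 * b1) = B by apply: (mulIf a10); rewrite -e1; ring.
  have A0 : A != 0.
    apply/eqP => A0; apply: ABC => //; first by rewrite -BE A0 mul0r.
    by apply: (mulIf a10); rewrite -e2 A0 !mul0r.
  have a2E : a2 = f' / A by apply: (mulIf A0); rewrite divfK // F'E -BE; ring.
  (* The claim becomes [a1 f = - f'], obtained by replacing [a1 C] and [B] through the relations. *)
  split=> //; apply: (mulIf f0); rewrite mulNr divfK // FE !mulrDr.
  rewrite [a1 * C]mulrC -e2 -BE F'E -BE; ring.
split; last by move=> a1 a2 /necessary[].
split=> [[a1 [a2 h]]|[f'f [A0 BA] lt]].
  have [A0 a1E a2E a12] := necessary _ _ h; have [_ [_ O1 O2] _] := h.
  split; last by rewrite -abs_a12 // -a1E -a2E.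
    by rewrite -[_ / _]opprK -a1E; exact: in_ZinvpN.
  (* Since [f' = 2 A b1 + B], integrality of [a2] and of [B / A] differ only by [2 b1]; the converse
     uses this too. *)
  split=> //; have -> : B / A = a2 + - (b1 + b1) by rewrite a2E F'E; field.
  by apply: in_ZinvpD => //; apply: in_ZinvpN; exact: in_ZinvpD.
exists (- (f' / f)), (f' / A); split; last by apply: cf12_converges; rewrite abs_a12.
- apply/VF12E; move: f0; rewrite F'E FE => f0; split; field; rewrite ?A0 ?f0 //.
- split=> //; first exact: in_ZinvpN.
  have -> : f' / A = b1 + b1 + B / A by rewrite F'E; field.
  by apply: in_ZinvpD => //; exact: in_ZinvpD.
Qed.
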